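(* Let $G$ be a simple undirected graph on $n$ vertices with minimum degree $\delta(G)=1$. Then the minimum $\alpha\in(0,1)$ such that $A_\alpha(G)=\alpha D(G)+(1-\alpha)A(G)$ is positive semi-definite is $$\alpha_0(G)=\frac{\lambda_n(\mathcal{A})}{\lambda_n(\mathcal{A})-1}.$$
   Context: For a graph $G$ on $n$ vertices, $A(G)$ is the $n\times n$ adjacency matrix, $D=D(G)$ is the diagonal matrix of vertex degrees, and $\mathcal{A}=\mathcal{A}(G)=D^{-1/2}A(G)D^{-1/2}$ is the normalized adjacency matrix. For a real symmetric $n\times n$ matrix $M$, $\lambda_n(M)$ denotes its smallest eigenvalue. For $\alpha\in[0,1]$, $A_\alpha(G)=\alpha D(G)+(1-\alpha)A(G)$. *)

(* Defs.v *)
From mathcomp Require Import all_boot all_order all_algebra.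
From mathcomp Require Import polyorder polyrcf.

Set Implicit Arguments.
Unset Strict Implicit.
Unset Printing Implicit Defensive.

Import Order.TTheory GRing.Theory Num.Theory.
Local Open Scope ring_scope.

Section Graph.
Variables (R : rcfType) (n : nat) (e : rel 'I_n).

Definition deg (i : 'I_n) : nat := #|[set j | e i j]|.

(* Every degree is at most n, so the default value n is harmless as soon as
   0 < n; for n = 0 the value is 0. *)
Definition min_degree : nat := \big[minn/n]_(i < n) deg i.

Definition adj_mx : 'M[R]_n := \matrix_(i, j) (e i j)%:R.

Definition deg_mx : 'M[R]_n := diag_mx (\row_i (deg i)%:R).

Definition deg_mx_invsqrt : 'M[R]_n :=
  diag_mx (\row_i (Num.sqrt (deg i)%:R)^-1).

Definition normalized_adj_mx : 'M[R]_n :=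
  deg_mx_invsqrt *m adj_mx *m deg_mx_invsqrt.

Definition A_alpha (alpha : R) : 'M[R]_n :=
  alpha *: deg_mx + (1 - alpha) *: adj_mx.

Lemma min_degreeP (d : nat) : (0 < n)%N ->
  min_degree = d <-> (forall i, (d <= deg i)%N) /\ (exists i, deg i = d).
Proof.
move=> n_gt0.
have min_le i : (min_degree <= deg i)%N.
  rewrite /min_degree; have := mem_index_enum i.
  elim: (index_enum _) => // j r IHr; rewrite inE big_cons geq_min.
  by case/predU1P => [<-|/IHr ->]; rewrite ?leqnn ?orbT.
have le_n i : (deg i <= n)%N by rewrite -[leqRHS]card_ord max_card.
have : min_degree = n \/ exists i, deg i = min_degree.
  rewrite /min_degree.
  elim/big_ind: _ => [|x y xP yP|i _]; [by left | | by right; exists i].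
  by rewrite /minn; case: ifP.
move=> minP.
have {minP} [i0 i0P] : exists i, deg i = min_degree.
  case: minP => // min_n; exists (Ordinal n_gt0).
  by apply/eqP; rewrite eqn_leq min_le min_n le_n.
split=> [<-|[d_le [i iP]]]; first by split=> //; exists i0.
by apply/eqP; rewrite eqn_leq -{1}iP min_le -i0P d_le.
Qed.

End Graph.

Section Matrix.
Variables (R : rcfType) (n : nat).
Implicit Type M : 'M[R]_n.

(* lambda_n of a real symmetric matrix: [rootsR] lists all the
   roots of a polynomial in R in increasing order, and the roots of [char_poly M]
   are the eigenvalues of M (see [lambda_minP]); the default 0 is only used if
   M has no eigenvalue in R. *)
Definition lambda_min M : R := head 0 (rootsR (char_poly M)).

Lemma lambda_minP M (a : R) : eigenvalue M a ->
  eigenvalue M (lambda_min M) /\ (forall b, eigenvalue M b -> lambda_min M <= b).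
Proof.
have mem_roots b : eigenvalue M b = (b \in rootsR (char_poly M)).
  have /(_ b) <- := roots_on_rootsR (monic_neq0 (char_poly_monic M)).
  by rewrite in_itv /= eigenvalue_root_char.
rewrite mem_roots /lambda_min.
have: sorted <%R (rootsR (char_poly M)) by exact: sorted_roots.
case: (rootsR _) mem_roots => //= c s mem_s.
rewrite (path_sortedE lt_trans) => /andP[/allP c_lt _] _; split.
  by rewrite mem_s mem_head.
by move=> b; rewrite mem_s inE => /predU1P[->|/c_lt /ltW].
Qed.

Definition psd M : Prop :=
  M^T = M /\ forall x : 'cV[R]_n, 0 <= (x^T *m M *m x) 0 0.

End Matrix.

(* Main.v *)
(** Let S = D^(1/2). As no vertex is isolated, S is invertible and
    A_alpha = S (alpha I + (1 - alpha) N) S with N the normalized adjacency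
    matrix, so A_alpha is positive semidefinite iff
    alpha + (1 - alpha) lambda >= 0, where lambda is the minimum of the
    Rayleigh quotient of N, i.e. iff alpha >= lambda / (lambda - 1). Testing the
    quotient on the difference of the basis vectors at the two ends of an edge
    gives lambda < 0, whence 0 < lambda / (lambda - 1) < 1. The spectral theorem
    for symmetric matrices over R is obtained from the unitary diagonalization
    over the algebraically closed field R[i]. *)
Require Import Defs.
From mathcomp Require Import all_boot all_order all_algebra.
From mathcomp Require Import spectral complex.

Set Implicit Arguments.
Unset Strict Implicit.
Unset Printing Implicit Defensive.

Import Order.TTheory GRing.Theory Num.Theory.
Local Open Scope ring_scope.

Section SymmetricSpectrum.
Variables (R : rcfType) (n : nat) (M : 'M[R]_n).
Hypothesis M_sym : M^T = M.

Local Notation toC := (real_complex R).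
Local Notation MC := (map_mx toC M).
Local Open Scope sesquilinear_scope.

Lemma map_conjC_real_complex m p (B : 'M[R]_(m, p)) :
  (map_mx toC B) ^ Num.conj = map_mx toC B.
Proof.
apply/matrixP => i j; rewrite !mxE; apply: conj_Creal.
by apply/complex_realP; exists (B i j).
Qed.

Lemma real_complex_symmetric_hermsymmx : MC \is hermsymmx.
Proof.
apply: realsym_hermsym.
  (* Symmetry is encoded as a hermitian form with sign [(-1) ^+ 0] and the identity as
     conjugation. *)
  by apply/is_hermitianmxP; rewrite expr0 scale1r map_mx_id // map_trmx M_sym.
by apply/mxOverP => i j; rewrite mxE; apply/complex_realP; exists (M i j).
Qed.

Lemma spectral_decomposition :
  MC = (spectralmx MC)^t* *m diag_mx (spectral_diag MC) *m spectralmx MC.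
Proof.
rewrite -invmx_unitary ?spectral_unitarymx //.
exact/orthomx_spectralP/hermitian_normalmx/real_complex_symmetric_hermsymmx.
Qed.

(** The spectral diagonal of a Hermitian matrix is real, and row [i] of the unitary matrix is a left
    eigenvector for entry [i]. The eigenvalue descends to [R] because [toC] is a field embedding. *)
Lemma spectral_diag_eigenvalue i :
  exists2 d : R, spectral_diag MC 0 i = toC d & eigenvalue M d.
Proof.
have /mxOverP/(_ 0 i)/complex_realP[d dE] :=
  hermitian_spectral_diag_real real_complex_symmetric_hermsymmx.
exists d => //; rewrite -(eigenvalue_map toC).
have /unitarymxP PP := spectral_unitarymx MC.
apply/eigenvalueP; exists (row i (spectralmx MC)).
  rewrite {2}spectral_decomposition !mulmxA -row_mul PP row1.
  by rewrite -rowE row_diag_mx -scalemxAl -rowE dE.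
(* A zero row [i] would make row [i] of the identity zero. *)
apply: contra_eqN PP => /eqP Pi0; apply/eqP => /(congr1 (row i)).
rewrite row_mul Pi0 mul0mx row1 => /rowP/(_ i)/eqP.
by rewrite !mxE !eqxx eq_sym oner_eq0.
Qed.

(** Any diagonal entry of the spectral form supplies an eigenvalue in [R], so the default value in
    [lambda_min] is never reached. *)
Lemma symmetric_lambda_minP : (0 < n)%N ->
  eigenvalue M (lambda_min M) /\ (forall b, eigenvalue M b -> lambda_min M <= b).
Proof.
move=> n_gt0.
by have [d _ /lambda_minP] := spectral_diag_eigenvalue (Ordinal n_gt0).
Qed.

(** In the unitary coordinates [z] the two sides become weighted sums of the squared moduli of the
    [z i], with weights [l] and the eigenvalues of [M]; these are compared term by term over
    [R[i]]. *)
Lemma rayleigh_lower_bound (l : R) (x : 'cV[R]_n) :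
  (forall b, eigenvalue M b -> l <= b) ->
  l * (x^T *m x) 0 0 <= (x^T *m M *m x) 0 0.
Proof.
move=> l_le; rewrite -lecR rmorphM /=.
pose xC := map_mx toC x; pose z := spectralmx MC *m xC.
have xCt : xC^t* = map_mx toC x^T by rewrite -map_conjC_real_complex map_trmx.
have zt : z^t* = xC^t* *m (spectralmx MC)^t* by rewrite trmx_mul map_mxM.
have -> : toC ((x^T *m x) 0 0) = (z^t* *m z) 0 0.
  have -> : z^t* *m z = map_mx toC (x^T *m x).
    rewrite zt mulmxA mulmxKtV ?spectral_unitarymx //.
    by rewrite xCt map_mxM.
  by rewrite [RHS]mxE.
have -> : toC ((x^T *m M *m x) 0 0) =
    (z^t* *m diag_mx (spectral_diag MC) *m z) 0 0.
  have -> : z^t* *m diag_mx (spectral_diag MC) *m z = map_mx toC (x^T *m M *m x).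
    rewrite (map_mxM toC (x^T *m M)) (map_mxM toC x^T) -xCt.
    by rewrite [in RHS]spectral_decomposition zt /z !mulmxA.
  by rewrite [RHS]mxE.
rewrite !mxE mulr_sumr; apply: ler_sum => i _.
have [d dE /l_le ld] := spectral_diag_eigenvalue i.
rewrite mul_mx_diag !mxE dE -mulrA [_ * (toC d * _)]mulrCA.
by rewrite ler_wpM2r ?lecR // mulrC mul_conjC_ge0.
Qed.

End SymmetricSpectrum.

Section NormalizedAdjacency.
Variables (R : rcfType) (n : nat) (e : rel 'I_n).
Hypothesis e_sym : symmetric e.

Local Notation N := (normalized_adj_mx R e).

Definition deg_mx_sqrt : 'M[R]_n := diag_mx (\row_i Num.sqrt (deg e i)%:R).

Lemma adj_mx_sym : (adj_mx R e)^T = adj_mx R e.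
Proof. by apply/matrixP => i j; rewrite !mxE e_sym. Qed.

Lemma normalized_adj_mx_sym : N^T = N.
Proof. by rewrite !trmx_mul !tr_diag_mx adj_mx_sym mulmxA. Qed.

Lemma A_alpha_sym (alpha : R) : (A_alpha e alpha)^T = A_alpha e alpha.
Proof. by rewrite linearD !linearZ /= tr_diag_mx adj_mx_sym. Qed.

Hypothesis deg_gt0 : forall i, (0 < deg e i)%N.

Lemma sqrt_deg_neq0 i : Num.sqrt (deg e i)%:R != 0 :> R.
Proof. by rewrite gt_eqF // sqrtr_gt0 ltr0n. Qed.

Lemma deg_mx_sqrtK : deg_mx_sqrt *m deg_mx_invsqrt R e = 1%:M.
Proof.
rewrite mulmx_diag -diag_const_mx; congr diag_mx; apply/rowP => i.
by rewrite !mxE divff ?sqrt_deg_neq0.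
Qed.

Lemma A_alpha_factor (alpha : R) :
  A_alpha e alpha = deg_mx_sqrt *m (alpha%:M + (1 - alpha) *: N) *m deg_mx_sqrt.
Proof.
have KV : deg_mx_invsqrt R e *m deg_mx_sqrt = 1%:M by exact/mulmx1C/deg_mx_sqrtK.
rewrite mulmxDr mulmxDl mul_mx_scalar -scalemxAl -scalemxAr -scalemxAl.
rewrite /normalized_adj_mx !mulmxA deg_mx_sqrtK mul1mx -mulmxA KV mulmx1.
congr (_ *: _ + _); rewrite mulmx_diag; congr diag_mx; apply/rowP => i.
by rewrite !mxE -expr2 sqr_sqrtr ?ler0n.
Qed.

Lemma A_alpha_quad (alpha : R) (x : 'cV[R]_n) :
  let y := deg_mx_sqrt *m x in
  (x^T *m A_alpha e alpha *m x) 0 0 =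
  alpha * (y^T *m y) 0 0 + (1 - alpha) * (y^T *m N *m y) 0 0.
Proof.
move=> y; have yT : y^T = x^T *m deg_mx_sqrt by rewrite trmx_mul tr_diag_mx.
have -> : x^T *m A_alpha e alpha *m x =
    alpha *: (y^T *m y) + (1 - alpha) *: (y^T *m N *m y).
  rewrite A_alpha_factor !mulmxA -yT -!mulmxA -/y mulmxDl mul_scalar_mx mulmxDr.
  by rewrite -scalemxAl -!scalemxAr /normalized_adj_mx !mulmxA.
by rewrite mxE [X in X + _ = _]mxE [X in _ + X = _]mxE.
Qed.

(** Necessity comes from testing the form on an eigenvector for [lambda_min N]; sufficiency is the
    Rayleigh bound, multiplied by [1 - alpha >= 0]. *)
Lemma psd_A_alphaP (alpha : R) : (0 < n)%N -> alpha <= 1 ->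
  psd (A_alpha e alpha) <-> 0 <= alpha + (1 - alpha) * lambda_min N.
Proof.
move=> n_gt0 alpha_le1.
have [/eigenvalueP[v vN v_neq0] minN] :=
  symmetric_lambda_minP normalized_adj_mx_sym n_gt0.
split=> [[_ psdA]|alpha_ge].
  (* This vector is chosen so that [y] in [A_alpha_quad] is [v^T]. The form then equals the desired
     quantity times [v *m v^T], which is positive as [v] is nonzero. *)
  have := psdA (deg_mx_invsqrt R e *m v^T).
  rewrite A_alpha_quad (mulmxA deg_mx_sqrt) deg_mx_sqrtK mul1mx trmxK vN.
  rewrite -scalemxAl [(_ *: (v *m _)) 0 0]mxE mulrA -mulrDl pmulr_lge0 // lt_neqAle eq_sym.
  have vvE : (v *m v^T) 0 0 = \sum_i v 0 i ^+ 2.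
    by rewrite mxE; apply: eq_bigr => i _; rewrite mxE.
  rewrite vvE sumr_ge0 ?andbT => [|i _]; last exact: sqr_ge0.
  apply: contra v_neq0; rewrite psumr_eq0 => [/allP v0|i _]; last exact: sqr_ge0.
  by apply/eqP/rowP => i; have := v0 i (mem_index_enum i);
    rewrite sqrf_eq0 mxE => /eqP.
split=> [|x]; first exact: A_alpha_sym.
rewrite A_alpha_quad; set y := _ *m x.
have yy_ge0 : 0 <= (y^T *m y) 0 0.
  by rewrite mxE sumr_ge0 // => i _; rewrite mxE -expr2 sqr_ge0.
apply: le_trans (mulr_ge0 alpha_ge yy_ge0) _.
rewrite mulrDl lerD2l -mulrA ler_wpM2l ?subr_ge0 //.
exact: (rayleigh_lower_bound normalized_adj_mx_sym y minN).
Qed.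

Lemma lambda_min_normalized_adj_lt0 (i : 'I_n) : irreflexive e -> lambda_min N < 0.
Proof.
move=> e_irr; have n_gt0 : (0 < n)%N by apply: leq_ltn_trans (ltn_ord i).
have [_ minN] := symmetric_lambda_minP normalized_adj_mx_sym n_gt0.
have /card_gt0P[j] := deg_gt0 i; rewrite inE => e_ij.
have NE k l : N k l = (Num.sqrt (deg e k)%:R)^-1 * (e k l)%:R *
    (Num.sqrt (deg e l)%:R)^-1.
  by rewrite /normalized_adj_mx mul_mx_diag mul_diag_mx !mxE.
have Nij_gt0 : 0 < N i j.
  by rewrite NE e_ij mulr1 mulr_gt0 // invr_gt0 sqrtr_gt0 ltr0n.
have Nji : N j i = N i j by rewrite -{1}normalized_adj_mx_sym mxE.
have Nkk k : N k k = 0 by rewrite NE e_irr mulr0 mul0r.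
(* The diagonal of [N] vanishes, so only the two cross terms of the edge survive, each equal to
   [- N i j]. *)
pose x : 'cV[R]_n := delta_mx i 0 - delta_mx j 0.
have := rayleigh_lower_bound normalized_adj_mx_sym x minN.
have q k l : ((delta_mx 0 k : 'rV[R]_n) *m N *m (delta_mx l 0 : 'cV[R]_n)) 0 0 = N k l.
  by rewrite -rowE -colE !mxE.
have -> : (x^T *m N *m x) 0 0 = - (N i j *+ 2).
  have subE (B C : 'M[R]_1) : (B - C) 0 0 = B 0 0 - C 0 0 by rewrite !mxE.
  have -> : x^T = delta_mx 0 i - delta_mx 0 j by rewrite linearB /= !trmx_delta.
  by rewrite /x mulmxBl mulmxBr !mulmxBl !subE !q !Nkk Nji sub0r subr0 mulr2n opprD.
have xx_ge0 : 0 <= (x^T *m x) 0 0.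
  by rewrite mxE sumr_ge0 // => k _; rewrite mxE -expr2 sqr_ge0.
(* A nonnegative minimum would force [0 <= - (N i j *+ 2)]. *)
move=> le_l; rewrite ltNge; apply/negP => l_ge0.
have := le_trans (mulr_ge0 l_ge0 xx_ge0) le_l.
by rewrite oppr_ge0 leNgt pmulrn_lgt0 ?Nij_gt0.
Qed.

End NormalizedAdjacency.

Theorem theorem2p3 (R : rcfType) (n : nat) (e : rel 'I_n)
    (e_sym : symmetric e) (e_irr : irreflexive e)
    (e_mindeg : min_degree e = 1%N) :
  let lambda_n := lambda_min (normalized_adj_mx R e) in
  let alpha0 := lambda_n / (lambda_n - 1) in
  [/\ 0 < alpha0 < 1,
      psd (A_alpha e alpha0)
    & forall alpha : R, 0 < alpha < 1 -> psd (A_alpha e alpha) ->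
        alpha0 <= alpha].
Proof.
move=> l a0.
(* For [n = 0] the empty minimum is its default [0], which differs from [1]. *)
have n_gt0 : (0 < n)%N.
  by rewrite lt0n; apply: contra_eqN e_mindeg => /eqP n0; subst n;
    rewrite /min_degree big_ord0.
have [deg_gt0 _] := (min_degreeP e 1 n_gt0).1 e_mindeg.
have l_lt0 : l < 0.
  exact: (lambda_min_normalized_adj_lt0 R e_sym deg_gt0 (Ordinal n_gt0) e_irr).
have l1_gt0 : 0 < 1 - l by rewrite subr_gt0 (lt_trans l_lt0).
have a0E : a0 = - l / (1 - l) by rewrite /a0 -[in RHS]opprB invrN mulrNN.
have a0_itv : 0 < a0 < 1.
  rewrite a0E divr_gt0 ?oppr_gt0 //= ltr_pdivrMr // mul1r.
  by rewrite -subr_gt0 opprK subrK.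
(* The left condition rearranges to [- l <= alpha * (1 - l)], and [1 - l] is positive. *)
have le_a0 (alpha : R) : (0 <= alpha + (1 - alpha) * l) = (a0 <= alpha).
  rewrite a0E ler_pdivrMr // -[RHS]subr_ge0; congr (0 <= _).
  by rewrite opprK mulrBr mulr1 mulrBl mul1r addrAC addrA.
split=> // [|alpha /andP[_ /ltW alpha_le1]].
  by have /andP[_ /ltW a0_le1] := a0_itv; apply/psd_A_alphaP; rewrite ?le_a0.
by move=> /psd_A_alphaP; rewrite le_a0; apply.
Qed.
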